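(* Let $1\le a\le b$ be integers and $g=\gcd(a,b)$. Furthermore, let $A\subset[0,g]$ with $\{0,g\}\subseteq A$. Let $r\in\mathbb R$, $r\ge1$, and let $I=I_A+I'$, where $I'$ is the ideal generated by all monomials $u\in K[x,y]$ with $\nu(u)>r$. Then $I_A$ is the quasi-equigenerated part of $I$, and (a) $r(I)=1$, if $r(I_A)=0$; (b) $r(I)=r(I_A)$, if $r(I_A)>0$. In particular, $r(I)\le g/\gcd(A)-|A|+2$.
   Context: $K$ is a field. For a monomial ideal $I\subset K[x,y]$, $G(I)$ is its unique minimal set of monomial generators. For a monomial $u=x^cy^d$ put $\nu(u)=(bc+ad)/(ab)$. $\mathcal I_{a,b}$ is the set of monomial ideals $I\subset K[x,y]$ with $x^a,y^b\in G(I)$ and $\nu(u)\ge1$ for all $u\in G(I)$. For $I\in\mathcal I_{a,b}$ and $J=(x^a,y^b)$, the reduction number $r(I)$ is the smallest integer $k\ge0$ with $I^{k+1}=JI^k$ (such $k$ exists). The quasi-equigenerated part of $I\in\mathcal I_{a,b}$ is the monomial ideal generated by all $u\in G(I)$ with $\nu(u)=1$. For $\{0,g\}\subseteq A\subseteq[0,g]$, $I_A=(x^{i\frac ag}y^{b-i\frac bg} : i\in A)$. $[c,d]$ denotes the set of integers $i$ with $c\le i\le d$; $\gcd(A)$ is the greatest common divisor of the integers in $A$, and $|A|$ is the number of elements of $A$. The symbol $r$ standing alone is the given real number; $r(\cdot)$ is the reduction number.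
   Formalization: Part (a) is stated under the extra assumption I ≠ I_A, since if r(I_A)=0 and I = I_A then r(I)=0 rather than 1 (e.g. a=b=1, A={0,1}, r=1, where I=I_A=(x,y)). *)

(* Defs.v *)
From mathcomp Require Import all_boot all_order all_algebra.
From mathcomp Require Import classical_sets reals.
From mathcomp Require Import mpoly.

Set Implicit Arguments.
Unset Strict Implicit.
Unset Printing Implicit Defensive.

Import Order.TTheory GRing.Theory Num.Theory.
Local Open Scope classical_set_scope.
Local Open Scope ring_scope.

(* K[x,y] is {mpoly K[2]}, with x = 'X_ord0 and y = 'X_ord_max; a monomial is
   identified with its exponent vector in 'X_{1..2}, and an ideal with its
   underlying set of polynomials. *)

Section Ideals.
Variable K : fieldType.
Implicit Types I J S : set {mpoly K[2]}.

Definition ideal_gen S : set {mpoly K[2]} :=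
  [set p | exists2 s : seq ({mpoly K[2]} * {mpoly K[2]}),
             (forall cq, cq \in s -> S cq.2)
           & p = \sum_(cq <- s) cq.1 * cq.2].

Definition ideal_add I J : set {mpoly K[2]} :=
  [set p | exists u v, [/\ I u, J v & p = u + v]].

Definition ideal_mul I J : set {mpoly K[2]} :=
  ideal_gen [set p | exists u v, [/\ I u, J v & p = u * v]].

(* The zeroth power is the unit ideal. *)
Definition ideal_exp I (k : nat) : set {mpoly K[2]} :=
  iter k (ideal_mul I) setT.

Definition mon_ideal (M : set 'X_{1..2}) : set {mpoly K[2]} :=
  ideal_gen [set 'X_[m] | m in M].

End Ideals.

Arguments mon_ideal : clear implicits.

Section MonomialIdeals.
Variable K : fieldType.
Implicit Types I : set {mpoly K[2]}.

Definition is_monomial_ideal I : Prop := exists M, I = mon_ideal K M.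

Definition minimal_mon_gens I (M : set 'X_{1..2}) : Prop :=
  I = mon_ideal K M /\
  forall N : set 'X_{1..2}, N `<=` M -> I = mon_ideal K N -> N = M.

(* G(I): a monomial ideal has exactly one minimal set of monomial generators,
   and [get] selects it. *)
Definition mingens I : set 'X_{1..2} := get (minimal_mon_gens I).

End MonomialIdeals.

Definition mxy (c d : nat) : 'X_{1..2} :=
  (U_(ord0) *+ c + U_(ord_max) *+ d)%MM.

Definition nu (a b : nat) (m : 'X_{1..2}) : rat :=
  (b * m ord0 + a * m ord_max)%N%:R / (a * b)%N%:R.

(* Membership in the class I_{a,b}. *)
Definition in_class (K : fieldType) (a b : nat) (I : set {mpoly K[2]}) : Prop :=
  [/\ is_monomial_ideal I,
      mingens I (mxy a 0),
      mingens I (mxy 0 b)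
    & forall m, mingens I m -> 1 <= nu a b m].

Definition idealJ (K : fieldType) (a b : nat) : set {mpoly K[2]} :=
  mon_ideal K [set m | m = mxy a 0 \/ m = mxy 0 b].

Arguments idealJ : clear implicits.

(* "r(I) = k". *)
Definition is_reduction_number (K : fieldType) (a b : nat)
    (I : set {mpoly K[2]}) (k : nat) : Prop :=
  ideal_exp I k.+1 = ideal_mul (idealJ K a b) (ideal_exp I k) /\
  forall j : nat,
    ideal_exp I j.+1 = ideal_mul (idealJ K a b) (ideal_exp I j) -> (k <= j)%N.

Definition quasi_equigenerated_part (K : fieldType) (a b : nat)
    (I : set {mpoly K[2]}) : set {mpoly K[2]} :=
  mon_ideal K [set m | mingens I m /\ nu a b m = 1].

(* The subtraction is not truncated, since i <= gcdn a b. *)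
Definition idealA (K : fieldType) (a b : nat) (A : {set 'I_(gcdn a b).+1}) :
    set {mpoly K[2]} :=
  mon_ideal K [set m | exists2 i, i \in A &
    m = mxy (i * (a %/ gcdn a b)) (b - i * (b %/ gcdn a b))].

Arguments idealA K {a b} A.

Definition ideal_above (K : fieldType) (R : realType) (a b : nat) (r : R) :
    set {mpoly K[2]} :=
  mon_ideal K [set m | r < ratr (nu a b m)].

Arguments ideal_above K {R} a b r.

Definition gcd_set (n : nat) (A : {set 'I_n}) : nat :=
  \big[gcdn/0%N]_(i in A) (i : nat).

(* Main.v *)
Require Import Defs.
From mathcomp Require Import all_boot all_order all_algebra.
From mathcomp Require Import boolp classical_sets reals.
From mathcomp Require Import mpoly zify lra.

(** A monomial ideal is determined by the set of exponents of its monomials,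
    which is closed under adding exponents, and products of monomial ideals
    correspond to sumsets of exponents.  So the equation I^(k+1) = J I^k says
    that two sumsets of points of N^2 have the same upward closure.  All
    computations use the additive weight b c + a d = a b nu(x^c y^d).

    Let G be the set of exponents of the generators of I_A; they all have
    weight a b, the minimum of the weight on I, so they are the generators u of
    I with nu(u) = 1.  A product of j + 1 generators of I that involves a
    generator of I' has nu > r + j.  Conversely a monomial with nu > t + 1 and
    t >= 1 has nu > 2, hence is divisible by x^a or y^b, and the quotient has
    nu > t; descending to nu > r, one finds that every monomial with nu > r + j
    lies in J^j I'.  Therefore
      I^(j+1) = I_A^(j+1) + (all monomials with nu > r + j)
    ([upset_exp_above]).  By the same division the second summand of I^(j+2)
    always lies in J I^(j+1), so for k >= 1 an equation I_A^(k+1) = J I_A^k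
    gives I^(k+1) = J I^k ([reduction_at_above]); comparing the monomials with
    nu = k + 1 gives the converse for all k ([reduction_at_part]).  This
    gives (b).  If r(I_A) = 0, then I_A = J, the equation for I holds at k = 1,
    and at k = 0 it says I = J = I_A.

    For the bound, a product of generators of I_A is determined by the number
    of factors and the sum of their indices in A.  So I_A^(k+1) = J I_A^k holds
    as soon as every sum of k + 1 elements of A is a sum of k + 1 elements of A
    one of which is 0 or g.  This is a pigeonhole argument
    ([sum_with_endpoint]): let d = gcd(A).  If no summand is g, the partial
    sums with at least two terms and the elements of A other than g reduce
    modulo g to multiples of d, and only g/d such residues exist.  When
    k + |A| >= g/d + 2 there are too many of them, so either two partial sums
    agree modulo g, or a partial sum agrees with some c in A.  In both cases a
    block of the summands can be replaced by copies of 0 and g, and c in the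
    second case, and at least one copy of 0 or g occurs. *)

Set Implicit Arguments.
Unset Strict Implicit.
Unset Printing Implicit Defensive.

Import Order.TTheory GRing.Theory Num.Theory.

(** * Sums of integers modulo an endpoint *)

Lemma sumn_le (g : nat) s : (forall x, x \in s -> (x <= g)%N) -> (sumn s <= size s * g)%N.
Proof.
elim: s => //= x s IH H; rewrite mulSn; apply: leq_add; first by apply: H; rewrite mem_head.
by apply: IH => y ys; rewrite H // inE ys orbT.
Qed.

Lemma sumn_dvd (d : nat) s : (forall x, x \in s -> (d %| x)%N) -> (d %| sumn s)%N.
Proof.
elim: s => //= x s IH H; apply: dvdn_add; first by apply: H; rewrite mem_head.
by apply: IH => y ys; rewrite H // inE ys orbT.
Qed.

Lemma sumn_lt (g : nat) s : (0 < size s)%N ->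
  (forall x, x \in s -> (x < g)%N) -> (sumn s < size s * g)%N.
Proof.
move=> s0 H; case: g H => [|g] H; first by case: s s0 H => // x s _ /(_ x (mem_head _ _)).
apply: (@leq_ltn_trans (size s * g)%N); last by rewrite ltn_pmul2l.
by apply: sumn_le => x /H.
Qed.

Lemma size_multiples_lt (g d : nat) (s : seq nat) : (0 < g)%N -> (d %| g)%N -> uniq s ->
  (forall x, x \in s -> (x < g)%N && (d %| x)%N) -> (size s <= g %/ d)%N.
Proof.
move=> g0 /dvdnP[q gE] us Hs.
have d0 : (0 < d)%N by case: d gE {Hs} => // gE; rewrite gE muln0 in g0.
rewrite gE mulnK // -[X in (_ <= X)%N](size_iota 0 q).
rewrite -[X in (_ <= X)%N](size_map (muln^~ d)) uniq_leq_size // => x /Hs.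
case/andP => xg /dvdnP[y xE]; apply/mapP; exists y => //.
by move: xg; rewrite mem_iota xE gE ltn_pmul2r.
Qed.

(** Replacing the block [s2] by [e] lowers the sum by a multiple of [g], which
    copies of [g] restore; copies of [0] then restore the length.  Since [e] is
    shorter than [s2], at least one such copy is used. *)
Lemma replace_block (B : seq nat) (g : nat) (s1 s2 s3 e : seq nat) :
  0 \in B -> g \in B -> (0 < g)%N -> {subset s1 ++ s2 ++ s3 <= B} ->
  {subset e <= B} -> (size e < size s2)%N -> sumn s2 = sumn e %[mod g] ->
  (sumn e <= sumn s2)%N -> (sumn s2 <= sumn e + (size s2 - size e) * g)%N ->
  exists t : seq nat, [/\ size t = size (s1 ++ s2 ++ s3), {subset t <= B},
     sumn t = sumn (s1 ++ s2 ++ s3) & (0 \in t) || (g \in t)].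
Proof.
move=> B0 Bg g0 sB eB lt_e eqm le1 le2.
have /dvdnP[q qE] : g %| sumn s2 - sumn e by rewrite -eqn_mod_dvd // eqm.
set k := (size s2 - size e)%N in le2.
have qk : (q <= k)%N by rewrite -(leq_pmul2r g0) -qE leq_subLR.
exists (s1 ++ (e ++ nseq q g ++ nseq (k - q) 0) ++ s3); split.
- by rewrite !size_cat !size_nseq; lia.
- move=> x; rewrite !mem_cat !mem_nseq -!orbA.
  case/or4P => [xs|/eB //|/andP[_ /eqP -> //]|/orP[/andP[_ /eqP -> //]|xs]];
    by apply: sB; rewrite !mem_cat xs ?orbT.
- by rewrite !sumn_cat !sumn_nseq; lia.
- rewrite !mem_cat !mem_nseq !eqxx !andbT.
  by case: (posnP q) => [->|_]; rewrite ?orbT // subn0 subn_gt0 lt_e ?orbT.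
Qed.

(** The combinatorial core of the bound: a long sum of elements of [B] can be
    rewritten, with the same number of summands, so as to use an endpoint [0]
    or [g].  The partial sums modulo [g] and the elements of [B] other than [g]
    compete for the [g %/ d] residues that are multiples of [d]; a coincidence
    yields a block whose sum is congruent to [0] or to an element of [B]. *)
Lemma sum_with_endpoint (B : seq nat) (g d : nat) (s : seq nat) :
  (0 < g)%N -> uniq B -> 0 \in B -> g \in B ->
  (forall x, x \in B -> (x <= g)%N && (d %| x)%N) ->
  {subset s <= B} -> (g %/ d + 3 <= size s + size B)%N ->
  exists t : seq nat, [/\ size t = size s, {subset t <= B},
     sumn t = sumn s & (0 \in t) || (g \in t)].
Proof.
move=> g0 uB B0 Bg HB sB big.
have [gs|gs] := boolP (g \in s); first by exists s; rewrite gs orbT.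
have ltg x : x \in s -> (x < g)%N.
  move=> xs; have /andP[] := HB x (sB x xs); rewrite leq_eqVlt => /orP[/eqP xg|//].
  by rewrite -xg xs in gs.
pose P j := sumn (take j s) %% g.
(* A single summand is itself an element of B, so replacing it by an element
   of B gains nothing: only partial sums with at least two terms count. *)
pose L := [seq P j | j <- iota 2 (size s).-1].
pose C := rem g B.
have memC x : x \in C -> x \in B /\ (x < g)%N.
  rewrite mem_rem_uniq // inE => /andP[xg xB]; split=> //.
  by have /andP[] := HB x xB; rewrite leq_eqVlt (negPf xg).
have dg : d %| g by have /andP[] := HB g Bg.
have : ~~ uniq (L ++ C).
  apply/negP => /(size_multiples_lt g0 dg) H.
  have : (0 < size B)%N by case: (B) B0.
  suff : (size (L ++ C) <= g %/ d)%N.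
    rewrite size_cat size_map size_iota size_rem //; move: big.
    by set n := (g %/ d)%N; set u := size s; set v := size B; lia.
  apply: H => x; rewrite mem_cat => /orP[/mapP[j _ ->]|/memC[xB ->]].
    rewrite ltn_mod g0 /P /dvdn modn_dvdm //; apply: sumn_dvd => y /mem_take ys.
    by have /andP[] := HB y (sB y ys).
  by have /andP[] := HB x xB.
rewrite cat_uniq rem_uniq // andbT negb_and negbK => /orP[/(uniqPn 0)[i [j]]|].
  rewrite size_map size_iota ltn_predRL => -[ij js].
  rewrite !(nth_map 0) ?size_iota ?nth_iota ?ltn_predRL //; try by lia.
  (* The terms between two congruent partial sums add up to 0 modulo g. *)
  rewrite /P => Pij.
  have tE : take (2 + j) s = take (2 + i) s ++ drop (2 + i) (take (2 + j) s).
    by rewrite -[LHS](cat_take_drop (2 + i)) take_takel //; lia.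
  have sE : s = take (2 + i) s ++ drop (2 + i) (take (2 + j) s) ++ drop (2 + j) s.
    by rewrite catA -tE cat_take_drop.
  have sz : size (drop (2 + i) (take (2 + j) s)) = (j - i)%N.
    by rewrite size_drop size_takel // subnDl.
  rewrite sE; apply: (@replace_block _ _ _ _ _ [::]) => //.
  - by rewrite -sE.
  - by rewrite sz /= subn_gt0.
  - by apply/eqP; rewrite -(eqn_modDl (sumn (take (2 + i) s))) -sumn_cat -tE addn0 Pij.
  - rewrite subn0 add0n; apply: sumn_le => x /mem_drop/mem_take xs.
    by rewrite ltnW ?ltg.
(* A partial sum of j >= 2 terms is congruent to c in B; as all terms are less
   than g, the quotient is at most j - 1, which leaves room for c. *)
case/hasP => c /memC[cB cg] /mapP[j]; rewrite mem_iota => jb; rewrite /P => cE.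
have sz : size (take j s) = j by rewrite size_takel; lia.
rewrite -(cat_take_drop j s); apply: (@replace_block _ g [::] _ _ [:: c]) => //=.
- by rewrite cat_take_drop.
- by move=> x /[!inE] /eqP ->.
- by rewrite sz; lia.
- by rewrite addn0 cE modn_mod.
- by rewrite addn0 cE leq_mod.
- have := @sumn_lt g (take j s); rewrite sz => /(_ _ _)/wrap[].
  + lia.
  + by move=> x /mem_take /ltg.
  + rewrite addn0 {2}(divn_eq (sumn (take j s)) g) -cE => le.
    rewrite addnC leq_add2l leq_mul2r -ltnS; apply/orP; right.
    rewrite -(ltn_pmul2r g0).
    lia.
Qed.

(** * Monomial ideals as upward closed sets of exponents *)

Local Open Scope ring_scope.
Local Open Scope classical_set_scope.

Implicit Types M N : set 'X_{1..2}.

Lemma forall_ord2 (P : 'I_2 -> Prop) : P ord0 -> P ord_max -> forall i, P i.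
Proof.
move=> P0 P1 i; case: (unliftP ord0 i) => [j ->|-> //].
by rewrite (ord1 j) (_ : lift _ _ = ord_max) //; apply/val_inj.
Qed.

Lemma mnm2P (m n : 'X_{1..2}) : m ord0 = n ord0 -> m ord_max = n ord_max -> m = n.
Proof. by move=> e0 e1; apply/mnmP; apply: forall_ord2. Qed.

Lemma mnm2_leP (m n : 'X_{1..2}) :
  (m ord0 <= n ord0)%N -> (m ord_max <= n ord_max)%N -> (m <= n)%MM.
Proof. by move=> e0 e1; apply/mnm_lepP; apply: forall_ord2. Qed.

Lemma mxyE c d : (mxy c d ord0 = c) * (mxy c d ord_max = d).
Proof. by split; rewrite /mxy mnmDE !mulmnE !mnm1E /=; lia. Qed.

Definition upset M : set 'X_{1..2} := [set m | exists2 n, M n & (n <= m)%MM].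

Definition sumset M N : set 'X_{1..2} := [set (m + n)%MM | m in M & n in N].

Definition sumset_exp M k : set 'X_{1..2} := iter k (sumset M) [set 0%MM].

Definition minimals M : set 'X_{1..2} :=
  [set m | M m /\ forall n, M n -> (n <= m)%MM -> n = m].

Lemma sub_upset M : M `<=` upset M.
Proof. by move=> m Mm; exists m => //; apply/mnm_lepP. Qed.

Lemma lepm_trans (l m n : 'X_{1..2}) : (l <= m)%MM -> (m <= n)%MM -> (l <= n)%MM.
Proof.
by move=> /mnm_lepP lm /mnm_lepP mn; apply/mnm_lepP=> i; apply: leq_trans (mn i).
Qed.

Lemma lepm_add (m n m' n' : 'X_{1..2}) :
  (m <= m')%MM -> (n <= n')%MM -> (m + n <= m' + n')%MM.
Proof.
by move=> /mnm_lepP lm /mnm_lepP mn; apply/mnm_lepP=> i; rewrite !mnmDE leq_add.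
Qed.

Lemma upset_closed M m n : upset M m -> (m <= n)%MM -> upset M n.
Proof. by case=> l Ml lm mn; exists l => //; apply: lepm_trans mn. Qed.

Lemma upset_sub M N : M `<=` upset N -> upset M `<=` upset N.
Proof. by move=> MN m [n /MN Nn nm]; apply: upset_closed nm. Qed.

Lemma upset_mono M N : M `<=` N -> upset M `<=` upset N.
Proof. by move=> MN; apply: upset_sub => m /MN; apply: sub_upset. Qed.

Lemma upset_add M N m n : upset M m -> upset N n -> upset (sumset M N) (m + n)%MM.
Proof.
case=> m' Mm' lm [n' Nn' ln]; exists (m' + n')%MM; last exact: lepm_add.
by exists m' => //; exists n'.
Qed.

Lemma mdeg2 (m : 'X_{1..2}) : mdeg m = (m ord0 + m ord_max)%N.
Proof.
rewrite mdegE big_ord_recl big_ord1.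
by congr (_ + m _)%N; apply/val_inj.
Qed.

(** By induction on the degree, every exponent of [M] lies above a minimal
    one. *)
Lemma upset_minimals M : upset (minimals M) = upset M.
Proof.
apply/seteqP; split; first by apply: upset_mono => m [].
apply: upset_sub => m.
have [k] := ubnP (mdeg m); elim: k m => // k IH m ltk Mm.
have [[n [Mn nm neq]]|mmin] :=
  pselect (exists n, [/\ M n, (n <= m)%MM & n <> m]); last first.
  apply: sub_upset; split => // n Mn nm; apply: contrapT => neq.
  by apply: mmin; exists n.
apply: upset_closed (nm); apply: IH => //; apply: leq_trans (ltk : (mdeg m <= k)%N).
rewrite !mdeg2 ltnNge; apply/negP => le; apply: neq.
move/mnm_lepP: nm => nm; have := nm ord0; have := nm ord_max => ? ?.
by apply: mnm2P; lia.
Qed.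

Lemma minimals_upset M : minimals (upset M) = minimals M.
Proof.
apply/seteqP; split=> m.
  case=> -[n Mn nm] mmin; have nE : n = m by apply: mmin nm; apply: sub_upset.
  by rewrite -nE in mmin *; split => // l /sub_upset; apply: mmin.
case=> Mm mmin; split; first exact: sub_upset.
move=> n [l Ml ln] nm; have lE := mmin l Ml (lepm_trans ln nm).
rewrite {}lE in ln; move/mnm_lepP: nm => nm; move/mnm_lepP: ln => ln.
by apply/mnmP => i; apply/eqP; rewrite eqn_leq nm ln.
Qed.

Lemma sumset_mono M M' N N' : M `<=` M' -> N `<=` N' -> sumset M N `<=` sumset M' N'.
Proof. by move=> MM NN _ [m /MM Mm [n /NN Nn <-]]; exists m => //; exists n. Qed.

Lemma sumset_exp_mono M N k : M `<=` N -> sumset_exp M k `<=` sumset_exp N k.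
Proof. by move=> MN; elim: k => // k IH; apply: sumset_mono. Qed.

Lemma upset_sumset M N : upset (sumset M (upset N)) = upset (sumset M N).
Proof.
apply/seteqP; split; last first.
  by apply: upset_mono; apply: sumset_mono; [move=> ?|exact: sub_upset].
by apply: upset_sub => _ [m Mm [n Nn <-]]; apply: upset_add => //; apply: sub_upset.
Qed.

Lemma sumset_exp1 M : sumset_exp M 1 = M.
Proof.
apply/seteqP; split=> [_ [m Mm [_ -> <-]]|m Mm]; first by rewrite addm0.
by exists m => //; exists 0%MM => //; rewrite addm0.
Qed.

Section Ideals.
Variable K : fieldType.
Implicit Types (p q : {mpoly K[2]}) (S T : set {mpoly K[2]}).

Lemma ideal_gen_mul S c q : S q -> ideal_gen S (c * q).
Proof.
by move=> Sq; exists [:: (c, q)]; [move=> cq /[!inE] /eqP -> | rewrite big_seq1].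
Qed.

Lemma ideal_gen_mono S T : S `<=` T -> ideal_gen S `<=` ideal_gen T.
Proof. by move=> ST p [s Hs ->]; exists s => // cq /Hs /ST. Qed.

Lemma ideal_gen0 S : ideal_gen S 0.
Proof. by exists [::]; rewrite ?big_nil. Qed.

Lemma ideal_genD S p q : ideal_gen S p -> ideal_gen S q -> ideal_gen S (p + q).
Proof.
move=> [s Hs ->] [t Ht ->]; exists (s ++ t); last by rewrite big_cat.
by move=> cq; rewrite mem_cat => /orP[/Hs|/Ht].
Qed.

(** The dictionary between ideals and exponents: a polynomial lies in a
    monomial ideal exactly when each of its monomials is divisible by a
    generator. *)
Lemma mon_idealP M p :
  mon_ideal K M p <-> forall m, m \in msupp p -> upset M m.
Proof.
split=> [[s Hs ->]|Hp].
  elim: s Hs => [|[c q] s IH] Hs m; first by rewrite big_nil msupp0.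
  rewrite big_cons => /msuppD_le; rewrite mem_cat => /orP[|]; last first.
    by apply: IH => cq cqs; apply: Hs; rewrite inE cqs orbT.
  have [n Mn /= <-] := Hs (c, q) (mem_head _ _).
  rewrite (perm_mem (msuppMX _ _)) => /mapP[l _ ->]; exists n => //.
  by apply/mnm_lepP=> i; rewrite mnmDE leq_addr.
rewrite (mpolyE p) big_seq; apply: big_ind => [||m /Hp[n Mn nm]].
- exact: ideal_gen0.
- exact: ideal_genD.
- rewrite -(submK nm) mpolyXD scalerAl; apply: ideal_gen_mul.
  by exists n.
Qed.

Lemma mon_idealX M m : mon_ideal K M 'X_[m] <-> upset M m.
Proof.
rewrite mon_idealP; split=> [|Mm n]; first by apply; rewrite msuppX inE.
by rewrite msuppX inE => /eqP ->.
Qed.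

Lemma mon_ideal_eqP M N : mon_ideal K M = mon_ideal K N <-> upset M = upset N.
Proof.
split=> E.
  by apply/seteqP; split=> m /(mon_idealX _ _).2; [rewrite E|rewrite -E] => /mon_idealX.
by apply/seteqP; split=> p /mon_idealP H; apply/mon_idealP => m /H; rewrite E.
Qed.

Lemma ideal_add_mon M N :
  ideal_add (mon_ideal K M) (mon_ideal K N) = mon_ideal K (M `|` N).
Proof.
apply/seteqP; split=> p.
  case=> u [v [/mon_idealP Mu /mon_idealP Nv ->]]; apply/mon_idealP => m.
  move/msuppD_le; rewrite mem_cat => /orP[/Mu|/Nv]; apply: upset_mono => l.
  - by left.
  - by right.
case=> s Hs ->; elim: s Hs => [|[c q] s IH] Hs.
  by rewrite big_nil; exists 0, 0; rewrite addr0; split=> //; apply: ideal_gen0.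
rewrite big_cons /=.
have /IH[u [v [Mu Nv ->]]] : forall cq, cq \in s -> [set 'X_[m] | m in M `|` N] cq.2.
  by move=> cq cqs; apply: Hs; rewrite inE cqs orbT.
have [n Mn /= <-] := Hs (c, q) (mem_head _ _).
case: Mn => [Mn|Nn].
  exists (c * 'X_[n] + u), v; rewrite addrA; split=> //.
  by apply: ideal_genD => //; apply: ideal_gen_mul; exists n.
exists u, (c * 'X_[n] + v); rewrite addrCA; split=> //.
by apply: ideal_genD => //; apply: ideal_gen_mul; exists n.
Qed.

Lemma ideal_mul_mon M N :
  ideal_mul (mon_ideal K M) (mon_ideal K N) = mon_ideal K (sumset M N).
Proof.
apply/seteqP; split; last first.
  apply: ideal_gen_mono => _ [_ [m Mm [n Nn <-]] <-].
  by exists 'X_[m], 'X_[n]; rewrite mpolyXD; split=> //; apply/mon_idealX/sub_upset.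
move=> _ [s Hs ->]; rewrite big_seq; apply: big_ind => [||[c q] /Hs /=].
- exact: ideal_gen0.
- exact: ideal_genD.
case=> u [v [/mon_idealP Mu /mon_idealP Nv ->]]; apply/mon_idealP => m.
case/msuppM_le/allpairsP=> -[l l'] /= [_ lS ->].
have {lS} : upset (sumset M N) l'.
  case/msuppM_le/allpairsP: lS => -[k k'] /= [/Mu Mk /Nv Nk' ->].
  exact: upset_add.
by move/upset_closed; apply; apply/mnm_lepP=> i; rewrite mnmDE leq_addl.
Qed.

Lemma ideal_exp_mon M k :
  ideal_exp (mon_ideal K M) k = mon_ideal K (sumset_exp M k).
Proof.
elim: k => [|k IH]; last by rewrite /ideal_exp iterS -/(ideal_exp _ _) IH ideal_mul_mon.
apply/seteqP; split=> // p _; apply/mon_idealP => m _; exists 0%MM => //.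
by apply/mnm_lepP => i; rewrite mnm0E.
Qed.

(** Any set of monomial generators contains all the minimal exponents, and
    these already generate; hence a minimal set of monomial generators exists
    and is unique, and [get] returns it. *)
Lemma mingens_mon M : mingens (mon_ideal K M) = minimals M.
Proof.
have mono N N' : N `<=` minimals N' -> upset N' = upset N -> N = minimals N'.
  move=> NN' E; apply/seteqP; split=> // m [N'm mmin].
  have [n Nn nm] : upset N m by rewrite -E; apply: sub_upset.
  by rewrite -(mmin n _ nm) //; case: (NN' n Nn).
have minM : minimal_mon_gens (mon_ideal K M) (minimals M).
  split; first by apply/mon_ideal_eqP; rewrite upset_minimals.
  by move=> N NM /mon_ideal_eqP; apply: mono.
have [E minG] : minimal_mon_gens (mon_ideal K M) (mingens (mon_ideal K M)).
  by apply: getPex; exists (minimals M).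
move/mon_ideal_eqP: E => E.
rewrite -(minimals_upset M) E minimals_upset; symmetry; apply: minG; first by move=> m [].
by apply/mon_ideal_eqP; rewrite upset_minimals.
Qed.

End Ideals.

(** * Adding the monomials above a level *)

Section Reduction.
Variables (a b : nat).
Hypotheses (a0 : (0 < a)%N) (b0 : (0 < b)%N).

(** [weight m] is [a * b * nu a b m]: the same grading, with values in the
    natural numbers. *)
Definition weight (m : 'X_{1..2}) : nat := (b * m ord0 + a * m ord_max)%N.

Lemma weightD m n : weight (m + n)%MM = (weight m + weight n)%N.
Proof. by rewrite /weight !mnmDE; lia. Qed.

Lemma weight_le m n : (m <= n)%MM -> (weight m <= weight n)%N.
Proof. by move/mnm_lepP => mn; rewrite leq_add // leq_mul2l mn orbT. Qed.

Lemma weight_inj_le m n : (m <= n)%MM -> (weight n <= weight m)%N -> m = n.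
Proof.
move=> /mnm_lepP mn w; have h0 := mn ord0; have h1 := mn ord_max.
have l0 : (b * m ord0 <= b * n ord0)%N by rewrite leq_mul2l h0 orbT.
have l1 : (a * m ord_max <= a * n ord_max)%N by rewrite leq_mul2l h1 orbT.
have [e0 e1] : (b * m ord0 = b * n ord0 /\ a * m ord_max = a * n ord_max)%N.
  by rewrite /weight in w; lia.
by apply: mnm2P; apply/eqP; [rewrite -(eqn_pmul2l b0) e0|rewrite -(eqn_pmul2l a0) e1].
Qed.

Definition exponentsJ : set 'X_{1..2} := [set m | m = mxy a 0 \/ m = mxy 0 b].

Lemma weightJ m : exponentsJ m -> weight m = (a * b)%N.
Proof. by case=> ->; rewrite /weight !mxyE; lia. Qed.

Section Real.
Variable R : realType.
Implicit Types t r : R.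

Definition above t : set 'X_{1..2} := [set m | t * (a * b)%:R < (weight m)%:R].

Lemma above_closed t m n : above t m -> (m <= n)%MM -> above t n.
Proof. by move=> tm /weight_le mn; apply: lt_le_trans tm _; rewrite ler_nat. Qed.

Lemma aboveE r : above r = [set m | r < ratr (nu a b m)].
Proof.
apply/funext => m; apply/propext; rewrite /above /nu /= fmorph_div /= !ratr_nat.
by rewrite ltr_pdivlMr // ltr0n muln_gt0 a0.
Qed.

(** A monomial divisible neither by [x^a] nor by [y^b] has [nu] less than 2,
    so a monomial of level above [t + 1 >= 2] can be divided by one of them,
    which lowers [nu] by exactly 1. *)
Lemma above_split t m : 1 <= t -> above (t + 1) m -> sumset exponentsJ (above t) m.
Proof.
move=> t1 tm.
have w2 : (2 * (a * b) < weight m)%N.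
  rewrite -(ltr_nat R); apply: le_lt_trans tm.
  rewrite natrM ler_wpM2r ?ler0n //; lra.
have split n : exponentsJ n -> (n <= m)%MM -> sumset exponentsJ (above t) m.
  move=> Jn nm; exists n => //; exists (m - n)%MM; last by rewrite addmC submK.
  move: tm; rewrite /above /= -{1}(submK nm) weightD (weightJ Jn) natrD.
  by rewrite mulrDl mul1r ltrD2r.
have [le_a|lt_a] := leqP a (m ord0).
  by apply: (split (mxy a 0)); [left|apply: mnm2_leP; rewrite mxyE].
apply: (split (mxy 0 b)); [by right|apply: mnm2_leP; rewrite mxyE //].
rewrite leqNgt; apply/negP => lt_b; move: w2; rewrite /weight.
have : (b * m ord0 <= b * a)%N by rewrite leq_mul2l ltnW // orbT.
have : (a * m ord_max <= a * b)%N by rewrite leq_mul2l ltnW // orbT.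
lia.
Qed.

Variable (G : set 'X_{1..2}) (r : R).
Hypotheses (JG : exponentsJ `<=` G) (wG : forall m, G m -> weight m = (a * b)%N).
Hypothesis r1 : 1 <= r.

Lemma weight_exp k m : sumset_exp G k m -> weight m = (k * (a * b))%N.
Proof.
elim: k m => [m ->|k IH _ [m /wG wm [n /IH wn <-]]]; first by rewrite /weight !mnm0E; lia.
by rewrite weightD wm wn mulSn.
Qed.

Lemma upset_exp_weight k m : upset (sumset_exp G k) m -> (k * (a * b) <= weight m)%N.
Proof. by case=> n /weight_exp <- /weight_le. Qed.

Let GI := G `|` above r.

(** This describes [I^(j+1)]: the pure products of the minimal weight
    generators and everything above the level [r + j].  A factor from [I']
    pushes a product above that level because the others have [nu >= 1]; the
    reverse inclusion divides repeatedly by generators of [J]. *)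
Lemma upset_exp_above j :
  upset (sumset_exp GI j.+1) = upset (sumset_exp G j.+1) `|` above (r + j%:R).
Proof.
have ab0 : 0 <= (a * b)%:R :> R by rewrite ler0n.
have lo k m : upset (sumset_exp G k) m -> k%:R * (a * b)%:R <= (weight m)%:R :> R.
  by move/upset_exp_weight; rewrite -(ler_nat R) natrM.
elim: j => [|j IH]; apply/seteqP; split=> m.
- case=> _ [n [Gn|rn] [_ -> <-]]; rewrite addm0 addr0 => nm.
    by left; exists n => //; exists n => //; exists 0%MM => //; rewrite addm0.
  by right; apply: above_closed nm.
- rewrite addr0; case=> [|rm]; first exact/upset_mono/sumset_exp_mono/subsetUl.
  by apply: sub_upset; exists m; [right|exists 0%MM => //; rewrite addm0].
- case=> _ [n GIn [l /sub_upset + <-]]; rewrite -/(sumset_exp GI j.+1) IH => lj nlm.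
  case: GIn lj => [Gn|rn] [Gl|rl].
  + by left; apply: upset_closed nlm; apply: upset_add Gl; apply: sub_upset.
  + right; apply: above_closed nlm; move: rl.
    by rewrite /above /= weightD (wG Gn) -natr1 natrD !mulrDl !mul1r; lra.
  + right; apply: above_closed nlm; move: (lo _ _ Gl) rn.
    by rewrite /above /= weightD -!natr1 natrD !mulrDl; lra.
  + right; apply: above_closed nlm; move: rl rn (ler_wpM2r ab0 r1).
    by rewrite /above /= weightD -!natr1 natrD !mulrDl; lra.
- case=> [|rm]; first exact/upset_mono/sumset_exp_mono/subsetUl.
  have : sumset GI (upset (sumset_exp GI j.+1)) m.
    have : sumset exponentsJ (above (r + j%:R)) m.
      by apply: above_split; rewrite ?ler_wpDr ?ler0n // -addrA natr1.
    apply: sumset_mono; first by move=> n /JG; left.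
    by move=> n rn; rewrite IH; right.
  by move/sub_upset; rewrite upset_sumset.
Qed.

Definition reduction_at M k :=
  upset (sumset_exp M k.+1) = upset (sumset exponentsJ (sumset_exp M k)).

(** The inclusion of [J M^k] in [M^(k+1)] is automatic when [M] contains
    [J]. *)
Lemma reduction_at_sub M k : exponentsJ `<=` M ->
  sumset_exp M k.+1 `<=` upset (sumset exponentsJ (sumset_exp M k)) -> reduction_at M k.
Proof.
move=> JM sub; apply/seteqP; split; first exact: upset_sub.
by apply: upset_mono; apply: sumset_mono.
Qed.

(** The monomials of [I^(k+1)] above the level [r + k] lie in [J I^k] by
    [above_split].  For [k = 0] the implication can fail: [I'] need not be
    contained in [J]. *)
Lemma reduction_at_above k : (0 < k)%N -> reduction_at G k -> reduction_at GI k.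
Proof.
case: k => // j _ redG; apply: reduction_at_sub; first by move=> n /JG; left.
move=> m /sub_upset; rewrite upset_exp_above redG => -[|rm].
  by apply: upset_mono; apply: sumset_mono => //; apply/sumset_exp_mono/subsetUl.
rewrite -upset_sumset; apply: sub_upset.
have : sumset exponentsJ (above (r + j%:R)) m.
  by apply: above_split; rewrite ?ler_wpDr ?ler0n // -addrA natr1.
by apply: sumset_mono => // n rn; rewrite upset_exp_above; right.
Qed.

(** The lowest weight occurring in [I^k] is [k * (a * b)], and only products of
    generators of minimal weight reach it. *)
Lemma exp_above_weight k m :
  sumset_exp GI k m -> (weight m <= k * (a * b))%N -> sumset_exp G k m.
Proof.
case: k => [//|j] /sub_upset; rewrite upset_exp_above => -[[n Gn nm]|rm] wm.
  by rewrite -(weight_inj_le nm) // (weight_exp Gn).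
move: rm; rewrite /above /= => rm.
have : (weight m)%:R <= (j.+1 * (a * b))%:R :> R by rewrite ler_nat.
rewrite natrM -natr1 => wm'; have := ler_wpM2r (ler0n R (a * b)%N) r1.
by move: rm wm'; rewrite !mulrDl; lra.
Qed.

(** Comparing weights: if a monomial of [I_A^(k+1)] lies in [J I^k], then its
    cofactor has the lowest weight possible in [I^k], so it comes from
    [I_A^k]. *)
Lemma reduction_at_part k : reduction_at GI k -> reduction_at G k.
Proof.
move=> redI; apply: reduction_at_sub => // m Gm; have wm := weight_exp Gm.
have : upset (sumset_exp GI k.+1) m.
  by apply: sub_upset; move: m Gm {wm}; apply/sumset_exp_mono/subsetUl.
rewrite redI => -[_ [n Jn [l Il <-]] nlm].
exists (n + l)%MM => //; exists n => //; exists l => //; apply: exp_above_weight => //.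
by have := weight_le nlm; rewrite weightD (weightJ Jn) wm mulSn leq_add2l.
Qed.

Lemma weight_ge_above m : GI m -> (a * b <= weight m)%N.
Proof.
case=> [/wG -> //|rm]; rewrite -(ler_nat R) ltW //; apply: le_lt_trans rm.
by rewrite ler_peMl ?ler0n.
Qed.

(** Divisibility strictly increases the weight, so an exponent of the lowest
    weight is a minimal generator. *)
Lemma minimals_weight_above m :
  minimals GI m /\ weight m = (a * b)%N <-> G m.
Proof.
split=> [[[GIm _] wm]|Gm]; last first.
  split; last exact: wG.
  split; first by left.
  by move=> n /weight_ge_above wn nm; apply: weight_inj_le => //; rewrite (wG Gm).
case: GIm => //; rewrite /above /= wm => rm.
by have := ler_wpM2r (ler0n R (a * b)%N) r1; rewrite mul1r leNgt rm.
Qed.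

End Real.
End Reduction.

Lemma reduction_at_succ a b M k : reduction_at a b M k -> exponentsJ a b `<=` M ->
  reduction_at a b M k.+1.
Proof.
move=> redM JM; apply: reduction_at_sub => // _ [m Mm [n /sub_upset + <-]].
rewrite -/(sumset_exp M k.+1) redM => -[_ [j Jj [l Ml <-]] jln].
exists (j + (m + l))%MM.
  by exists j => //; exists (m + l)%MM => //; exists m => //; exists l.
by move/mnm_lepP: jln => jln; apply/mnm_lepP => i; have := jln i; rewrite !mnmDE; lia.
Qed.

Section ReductionNumber.
Variable K : fieldType.

Lemma ideal_reductionP a b M k :
  ideal_exp (mon_ideal K M) k.+1 =
    ideal_mul (idealJ K a b) (ideal_exp (mon_ideal K M) k) <->
  reduction_at a b M k.
Proof. by rewrite !ideal_exp_mon ideal_mul_mon; apply: mon_ideal_eqP. Qed.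

Lemma is_reduction_numberP a b M k :
  is_reduction_number a b (mon_ideal K M) k <->
  reduction_at a b M k /\ forall j, reduction_at a b M j -> (k <= j)%N.
Proof.
by split=> -[redk mink]; split=> [|j /ideal_reductionP /mink //]; apply/ideal_reductionP.
Qed.

End ReductionNumber.

(** * The generators on the segment *)

Section Segment.
Variables (g p q : nat) (B : seq nat).
Hypotheses (B0 : 0%N \in B) (Bg : g \in B) (leB : forall i, i \in B -> (i <= g)%N).
Let a := (g * p)%N.
Let b := (g * q)%N.

Definition segment_exponents : set 'X_{1..2} :=
  [set m | exists2 i, i \in B & m = mxy (i * p) (g * q - i * q)].

Lemma exponentsJ_segment : exponentsJ a b `<=` segment_exponents.
Proof.
move=> _ [->|->]; first by exists g => //; rewrite subnn.
by exists 0%N => //; rewrite mul0n subn0.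
Qed.

Lemma weight_segment m : segment_exponents m -> weight a b m = (a * b)%N.
Proof.
move=> [i /leB ig ->]; rewrite /weight !mxyE -mulnBl /a /b.
by rewrite (_ : _ * q * _ = g * p * (q * i))%N; nia.
Qed.

(** The points of the segment depend affinely on the index, so a product of
    generators remembers only the number of factors and the sum of the
    indices. *)
Lemma sumset_exp_segment k m :
  sumset_exp segment_exponents k m <->
  exists s : seq nat, [/\ size s = k, {subset s <= B} &
    m = mxy (sumn s * p) (k * (g * q) - sumn s * q)].
Proof.
have add i s : (i <= g)%N -> {subset s <= B} ->
    (mxy (i * p) (g * q - i * q) + mxy (sumn s * p) (size s * (g * q) - sumn s * q) =
     mxy ((i + sumn s) * p) ((size s).+1 * (g * q) - (i + sumn s) * q))%MM.
  move=> ig sB; have sg : (sumn s <= size s * g)%N by apply: sumn_le => x /sB /leB.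
  apply: mnm2P; rewrite mnmDE !mxyE; first by rewrite mulnDl.
  have := leq_mul ig (leqnn q); have := leq_mul sg (leqnn q).
  by rewrite mulnDl mulSn -mulnA; lia.
elim: k m => [|k IH] m; split.
- by move=> ->; exists [::]; split=> //; apply: mnm2P; rewrite mxyE mnm0E.
- by case=> s [/size0nil -> _ ->]; apply: mnm2P; rewrite mxyE mnm0E.
- case=> _ [i iB ->] [n /IH[s [<- sB ->]] <-]; exists (i :: s); split=> //.
  + by move=> x /[!inE] /orP[/eqP ->|/sB].
  + by rewrite add //; apply: leB.
- case=> -[|i s]; first by case.
  case=> -[szk] sB ->; rewrite -szk in IH *.
  have iB : i \in B by apply: sB; rewrite mem_head.
  have tB : {subset s <= B} by move=> x xs; apply: sB; rewrite inE xs orbT.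
  rewrite -add ?leB //; exists (mxy (i * p) (g * q - i * q)); first by exists i.
  by exists (mxy (sumn s * p) (size s * (g * q) - sumn s * q)) => //; apply/IH; exists s.
Qed.

(** The indices [0] and [g] are those of [y^b] and [x^a], so a sum that uses an
    endpoint gives a factor in [J]. *)
Lemma reduction_at_segment d k : (0 < g)%N -> uniq B ->
  (forall i, i \in B -> (d %| i)%N) -> (g %/ d + 2 <= k + size B)%N ->
  reduction_at a b segment_exponents k.
Proof.
move=> g0 uB dB big; apply: reduction_at_sub; first exact: exponentsJ_segment.
move=> m /sumset_exp_segment[s [sz sB ->]].
have [||t [szt tB <- endt]] := @sum_with_endpoint B g d s g0 uB B0 Bg _ sB.
- by move=> x xB; rewrite leB ?dB.
- by rewrite sz addSn addnS ltnS.
rewrite {}sz in szt.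
have [c [ct cE]] : exists c, c \in t /\ (c = 0 \/ c = g)%N.
  by case/orP: endt => ?; [exists 0%N|exists g]; split=> //; [left|right].
have sumE : sumn t = sumn (c :: rem c t) by apply: perm_sumn; apply: perm_to_rem.
have szr : size (rem c t) = k by rewrite size_rem // szt.
have remB : {subset rem c t <= B} by move=> x /mem_rem /tB.
apply: sub_upset; exists (mxy (c * p) (g * q - c * q)).
  by case: cE => ->; [right; rewrite mul0n subn0|left; rewrite subnn].
exists (mxy (sumn (rem c t) * p) (k * (g * q) - sumn (rem c t) * q)).
  by apply/sumset_exp_segment; exists (rem c t).
have cg : (c <= g)%N by case: cE => ->.
have rg : (sumn (rem c t) <= k * g)%N by rewrite -szr; apply: sumn_le => x /remB /leB.
rewrite sumE /=; apply: mnm2P; rewrite mnmDE !mxyE; first by rewrite mulnDl.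
have := leq_mul cg (leqnn q); have := leq_mul rg (leqnn q).
by rewrite mulnDl mulSn -mulnA; lia.
Qed.
End Segment.

(** * The reduction numbers *)

Theorem theorem5p2 (K : fieldType) (R : realType) (a b : nat)
    (A : {set 'I_(gcdn a b).+1}) (r : R)
    (I_A := idealA K A)
    (I := ideal_add I_A (ideal_above K a b r)) :
  (1 <= a)%N -> (a <= b)%N ->
  ord0 \in A -> ord_max \in A ->
  1 <= r ->
  [/\ in_class a b I,
      quasi_equigenerated_part a b I = I_A
    & exists rI rA : nat,
        [/\ is_reduction_number a b I rI,
            is_reduction_number a b I_A rA,
            (* I <> I_A excludes only the case I = I_A = (x^a, y^b),
               where r(I) = 0. *)
            rA = 0%N -> I <> I_A -> rI = 1%N,
            (0 < rA)%N -> rI = rA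
          & rI%:Z <= (gcdn a b %/ gcd_set A)%:Z - #|A|%:Z + 2]].
Proof.
move=> a0 ab A0 Ag r1; have b0 : (0 < b)%N by apply: leq_trans ab.
set g := gcdn a b in A I_A I A0 Ag *; set d := gcd_set A.
have g0 : (0 < g)%N by rewrite gcdn_gt0 a0.
set p := (a %/ g)%N; set q := (b %/ g)%N.
have aE : (g * p)%N = a by rewrite mulnC divnK // dvdn_gcdl.
have bE : (g * q)%N = b by rewrite mulnC divnK // dvdn_gcdr.
pose B := [seq val i | i <- enum A].
have memB i : i \in A -> val i \in B by move=> iA; rewrite map_f ?mem_enum.
have BA x : x \in B -> exists2 i, i \in A & x = val i.
  by move=> /mapP[i]; rewrite mem_enum; exists i.
have B0 : 0%N \in B := memB _ A0.
have Bg : g \in B := memB _ Ag.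
have leB x : x \in B -> (x <= g)%N by case/BA => i _ ->; rewrite -ltnS ltn_ord.
have dB x : x \in B -> (d %| x)%N by case/BA => i iA ->; exact: (biggcdn_inf i iA (dvdnn _)).
have uB : uniq B by rewrite map_inj_uniq ?enum_uniq //; apply: val_inj.
have szB : size B = #|A| by rewrite size_map -cardE.
pose G := segment_exponents g p q B.
pose GI := (G `|` above a b r)%classic.
have I_AE : I_A = mon_ideal K G.
  rewrite /I_A /idealA -/g -/p -/q; congr (mon_ideal K _).
  apply/seteqP; split=> m [i iA ->]; rewrite -?bE; first by exists (val i); rewrite ?memB.
  by case/BA: iA => j jA ->; exists j; rewrite ?bE.
have IE : I = mon_ideal K GI.
  by rewrite /I I_AE /ideal_above -aboveE // ideal_add_mon.
have JG : (exponentsJ a b `<=` G)%classic.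
  by rewrite -aE -bE; apply: exponentsJ_segment.
have wG m : G m -> weight a b m = (a * b)%N.
  by rewrite -aE -bE; apply: weight_segment.
have nu_weight m : nu a b m = (weight a b m)%:R / (a * b)%:R by [].
have ab0 : (0 < (a * b)%:R :> rat) by rewrite ltr0n muln_gt0 a0.
have minG m : minimals GI m /\ weight a b m = (a * b)%N <-> G m.
  exact: minimals_weight_above.
have mingensI : mingens I = minimals GI by rewrite IE mingens_mon.
split.
- split; first by exists GI.
  + by rewrite mingensI; case: ((minG (mxy a 0)).2 (JG _ (or_introl erefl))).
  + by rewrite mingensI; case: ((minG (mxy 0 b)).2 (JG _ (or_intror erefl))).
  + move=> m; rewrite mingensI => -[GIm _].
    by rewrite nu_weight ler_pdivlMr // mul1r ler_nat (weight_ge_above wG r1 GIm).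
- rewrite /quasi_equigenerated_part mingensI I_AE; congr (mon_ideal K _).
  have nu1 m : nu a b m = 1 <-> weight a b m = (a * b)%N.
    rewrite nu_weight; split=> [nu1|->]; last by rewrite divff // gt_eqF.
    by apply/eqP; rewrite -(eqr_nat rat) -[X in X == _](divfK (lt0r_neq0 ab0)) nu1 mul1r.
  by apply/seteqP; split=> m; rewrite /= nu1 minG.
(* The bound is at least 1, which settles the case r(I) = 1: the elements of A
   other than g are multiples of d less than g. *)
have cardA : (#|A| <= (g %/ d).+1)%N.
  have := @size_multiples_lt g d (rem g B) g0 (dB g Bg) (rem_uniq _ uB).
  rewrite size_rem // szB => H; rewrite -subn1 leq_subLR in H.
  apply: H => x; rewrite mem_rem_uniq // inE => /andP[xg xB].
  by rewrite dB // ltn_neqAle xg leB.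
have redA : reduction_at a b G ((g %/ d).+2 - #|A|)%N.
  rewrite -{1}aE -{1}bE; apply: (@reduction_at_segment g p q B B0 Bg leB d) => //.
  by rewrite szB addn2 subnK // leqW.
have [rA redrA minrA] : exists2 rA, reduction_at a b G rA &
    forall j, reduction_at a b G j -> (rA <= j)%N.
  have exA : exists k, `[< reduction_at a b G k >].
    by exists ((g %/ d).+2 - #|A|)%N; apply/asboolP.
  by case: (ex_minnP exA) => k /asboolP redk mink; exists k => // j /asboolP /mink.
have rA_le : (rA <= (g %/ d).+2 - #|A|)%N := minrA _ redA.
have rAP : is_reduction_number a b I_A rA.
  by rewrite I_AE; apply/is_reduction_numberP.
have redI k : (0 < k)%N -> reduction_at a b G k -> reduction_at a b GI k.
  exact: reduction_at_above.
have redG k : reduction_at a b GI k -> reduction_at a b G k.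
  exact: reduction_at_part.
have bound k : (k <= (g %/ d).+2 - #|A|)%N ->
    k%:Z <= (g %/ d)%:Z - #|A|%:Z + 2.
  by move: cardA; set n := (g %/ d)%N; lia.
have [rA0|rA_gt0] := posnP rA; last first.
  exists rA, rA; split=> //; [|by move=> e; rewrite e in rA_gt0|exact: bound].
  by rewrite IE; apply/is_reduction_numberP; split; [exact: redI|move=> j /redG /minrA].
have [II_A|II_A] := pselect (I = I_A).
  by exists rA, rA; rewrite II_A; split=> //; apply: bound.
exists 1%N, rA; split=> //; [|by rewrite rA0|]; last first.
  by apply: bound; rewrite leq_subRL ?addn1 ?ltnS // leqW.
rewrite rA0 in redrA.
rewrite IE; apply/is_reduction_numberP; split.
  by apply: redI => //; apply: reduction_at_succ.
case=> // redI0; case: II_A; rewrite IE I_AE; apply/mon_ideal_eqP.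
by move: redI0 redrA; rewrite /reduction_at !sumset_exp1 => -> ->.
Qed.
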